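(* Let $p$ be an odd prime and $r\ge1$ an integer. Let $A,B\subset(\mathbb{Z}/p^r\mathbb{Z})^2$, $P=A\times B$, and $R\subset\mathcal{R}_r$. If $p\equiv3\pmod4$, then \[\Big|\mathcal{I}(P,R)-\frac{|P||R|}{p^{2r}}\Big|\ll p^{r-\frac12}|P|^{1/2}|R|^{1/2}|B|^{1/4}.\] If $p\equiv1\pmod4$, then \[\Big|\mathcal{I}(P,R)-\frac{|P||R|}{p^{2r}}\Big|\ll p^{r-\frac14}|P|^{1/2}|R|^{1/2}|B|^{1/4}.\]
   Context: $G_r=SO_2(\mathbb{Z}/p^r\mathbb{Z})$ is the group of matrices $\begin{bmatrix}a&-b\\ b&a\end{bmatrix}$ with $a^2+b^2\equiv1\pmod{p^r}$. $\mathcal{R}_r=G_r\times(\mathbb{Z}/p^r\mathbb{Z})^2$ (rigid motions). For $P\subset(\mathbb{Z}/p^r\mathbb{Z})^2\times(\mathbb{Z}/p^r\mathbb{Z})^2$ and $R\subset\mathcal{R}_r$, $\mathcal{I}(P,R)$ is the number of pairs $((g,\mathbf{z}),(\mathbf{x},\mathbf{y}))\in R\times P$ with $g\mathbf{y}+\mathbf{z}=\mathbf{x}$. $X\ll Y$ means $X\le CY$ for an absolute constant $C$. *)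

(* Defs.v *)
From mathcomp Require Export all_boot all_order all_algebra.
From mathcomp Require Export reals exp.

Set Implicit Arguments.
Unset Strict Implicit.
Unset Printing Implicit Defensive.

Import GRing.Theory Num.Theory.
Local Open Scope ring_scope.

(* 'Z_n is the ring of integers mod n only for n >= 2; below n = p ^ r with p
   prime and r >= 1.  rotmx a b is the matrix [[a, -b], [b, a]]. *)
Definition rotmx (n : nat) (a b : 'Z_n) : 'M['Z_n]_2 :=
  \matrix_(i < 2, j < 2)
    if i == j then a else if (i < j)%N then - b else b.

Definition SO2 (n : nat) : {set 'M['Z_n]_2} :=
  [set rotmx ab.1 ab.2
     | ab : 'Z_n * 'Z_n in [pred ab : 'Z_n * 'Z_n | ab.1 ^+ 2 + ab.2 ^+ 2 == 1]].

Definition rigid_motions (n : nat) : {set 'M['Z_n]_2 * 'cV['Z_n]_2} :=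
  setX (SO2 n) [set: 'cV['Z_n]_2].

Definition incidences (n : nat) (P : {set 'cV['Z_n]_2 * 'cV['Z_n]_2})
    (R : {set 'M['Z_n]_2 * 'cV['Z_n]_2}) : nat :=
  #|[set t in setX R P | let: ((g, z), (x, y)) := t in g *m y + z == x]|.

(* Main.v *)
Require Import Defs.
From mathcomp Require Import all_boot all_order all_algebra all_field.
From mathcomp Require Import reals exp.
From mathcomp Require Import ring zify.

Set Implicit Arguments.
Unset Strict Implicit.
Unset Printing Implicit Defensive.

Import Order.TTheory GRing.Theory Num.Theory.
Local Open Scope ring_scope.

(** Put n = p^r and let D(g,z) be n^2 times the number of pairs (x,y) of A x B
    with g y + z = x, minus |A||B|.  Fourier inversion writes D(g,z) as a sum
    over the nonzero frequencies m of chi_m(z) conj(A^(m)) B^(mg), so after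
    Cauchy-Schwarz over R and Parseval in z it suffices to bound
    S = sum_g |B^(mg)|^2 for each m <> 0.  By duality and Hoelder,
    S^4 <= |B|^3 n^2 E, where E is the additive energy of g |-> mg weighted by
    B^(mg).  One shows E <= M S^2 by counting the pairs of rotations with
    m (g1 + g2) = v, and for this the reduction mod p is enough.  Two rotations
    that agree on some m <> 0 are congruent mod p, and fibers of the reduction
    have at most p^(r-1) elements; this gives M = 2 p^(2r-1).  When p = 3 mod 4,
    a sum g1 + g2 that is nonzero mod p determines {g1, g2} mod p, and the
    remaining pairs g2 = -g1 mod p are handled by Schur's test; this gives
    M = 6 p^(2r-2). *)

(** * Circles over fields *)

Section CirclePlane.
Variable F : fieldType.
Hypothesis two_neq0 : (2 : F) != 0.

(** Polarization gives dot product 1, then Lagrange's identity gives cross product 0, and the two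
    products recover [(a, b)] from [(c, d)]. *)
Lemma circle_dist0 (a b c d : F) :
  a ^+ 2 + b ^+ 2 = 1 -> c ^+ 2 + d ^+ 2 = 1 ->
  (a - c) ^+ 2 + (b - d) ^+ 2 = 0 -> (a, b) = (c, d).
Proof.
move=> h1 h2 h3.
have dot1 : a * c + b * d = 1.
  apply: (mulfI two_neq0).
  have -> : 2 * (a * c + b * d) = (a ^+ 2 + b ^+ 2) + (c ^+ 2 + d ^+ 2)
     - ((a - c) ^+ 2 + (b - d) ^+ 2) by ring.
  by rewrite h1 h2 h3; ring.
have cross0 : a * d - b * c = 0.
  apply/eqP; rewrite -sqrf_eq0.
  have -> : (a * d - b * c) ^+ 2 = (a ^+ 2 + b ^+ 2) * (c ^+ 2 + d ^+ 2)
     - (a * c + b * d) ^+ 2 by ring.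
  by rewrite h1 h2 dot1; apply/eqP; ring.
congr pair.
  have -> : a = a * (c ^+ 2 + d ^+ 2) by rewrite h2 mulr1.
  have -> : a * (c ^+ 2 + d ^+ 2) = c * (a * c + b * d) + d * (a * d - b * c)
    by ring.
  by rewrite dot1 cross0 mulr1 mulr0 addr0.
have -> : b = b * (c ^+ 2 + d ^+ 2) by rewrite h2 mulr1.
have -> : b * (c ^+ 2 + d ^+ 2) = d * (a * c + b * d) - c * (a * d - b * c)
  by ring.
by rewrite dot1 cross0 mulr1 mulr0 subr0.
Qed.

(* In F[i], with g1 = a + bi, g2 = c + di and h = e + fi on the circle and
   w = g1 + g2 = h + h', conjugating gives g1 g2 conj(w) = w = h h' conj(w),
   so conj(w) (h - g1) (h - g2) = 0; below, u + iv = (h - g1) (h - g2). *)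
Lemma circle_sum_unique (a b c d e f : F) :
  a ^+ 2 + b ^+ 2 = 1 -> c ^+ 2 + d ^+ 2 = 1 -> e ^+ 2 + f ^+ 2 = 1 ->
  (a + c - e) ^+ 2 + (b + d - f) ^+ 2 = 1 ->
  (a + c) ^+ 2 + (b + d) ^+ 2 != 0 ->
  (e, f) = (a, b) \/ (e, f) = (c, d).
Proof.
move=> h1 h2 h3 h4 w0.
pose u := (e - a) * (e - c) - (f - b) * (f - d).
pose v := (e - a) * (f - d) + (f - b) * (e - c).
have X0 : (a + c) * u + (b + d) * v = 0.
  have -> : (a + c) * u + (b + d) * v =
     (a ^+ 2 + b ^+ 2 - 1) * c + (c ^+ 2 + d ^+ 2 - 1) * a
     - (e ^+ 2 + f ^+ 2 - 1) * (a + c - e)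
     - ((a + c - e) ^+ 2 + (b + d - f) ^+ 2 - 1) * e by rewrite /u /v; ring.
  by rewrite h1 h2 h3 h4; ring.
have Y0 : (a + c) * v - (b + d) * u = 0.
  have -> : (a + c) * v - (b + d) * u =
     (a ^+ 2 + b ^+ 2 - 1) * d + (c ^+ 2 + d ^+ 2 - 1) * b
     - (e ^+ 2 + f ^+ 2 - 1) * (b + d - f)
     - ((a + c - e) ^+ 2 + (b + d - f) ^+ 2 - 1) * f by rewrite /u /v; ring.
  by rewrite h1 h2 h3 h4; ring.
have : ((a + c) ^+ 2 + (b + d) ^+ 2) *
   (((e - a) ^+ 2 + (f - b) ^+ 2) * ((e - c) ^+ 2 + (f - d) ^+ 2)) = 0.
  transitivity (((a + c) * u + (b + d) * v) ^+ 2 +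
     ((a + c) * v - (b + d) * u) ^+ 2); first by rewrite /u /v; ring.
  by rewrite X0 Y0; ring.
move/eqP; rewrite mulf_eq0 (negPf w0) orFb mulf_eq0 => /orP[]/eqP.
  by move/circle_dist0 => H; left; apply: H.
by move/circle_dist0 => H; right; apply: H.
Qed.

End CirclePlane.

Lemma card_circle (F : finFieldType) :
  (#|[set t : F * F | (t.1 ^+ 2 + t.2 ^+ 2 == 1)%R]| <= 2 * #|F|)%N.
Proof.
rewrite -sum1_card (partition_big fst predT) //=.
apply: (@leq_trans (\sum_(a : F) 2)); last by rewrite sum_nat_const mulnC.
apply: leq_sum => a _; rewrite sum1_card.
set S := (X in (#|X| <= _)%N).
have Sdef u : S u -> u.1 ^+ 2 + u.2 ^+ 2 = 1 /\ u.1 = a.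
  by case/andP; rewrite inE => /eqP ? /eqP.
have [t tS|S0] := pickP S; last by rewrite eq_card0.
have [ht ta] := Sdef t tS.
apply: (@leq_trans #|[:: (a, t.2); (a, - t.2)]|); last exact: card_size.
apply: subset_leq_card; apply/subsetP => u uS.
have [hu ua] := Sdef u uS.
have : u.2 ^+ 2 == t.2 ^+ 2.
  by apply/eqP; apply: (addrI (a ^+ 2)); rewrite -{1}ua hu -ta.
rewrite eqf_sqr !inE [u]surjective_pairing ua /= => /orP[]/eqP->.
  by rewrite eqxx.
by rewrite eqxx orbT.
Qed.

Lemma Fp2_neq0 p : prime p -> odd p -> (2 : 'F_p) != 0.
Proof.
move=> pp op; rewrite -(dvdn_pcharf (pchar_Fp pp)).
by rewrite dvdn_prime2 //; apply/eqP => p2; move: op; rewrite p2.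
Qed.

(** If [y] is nonzero, [x / y] is a square root of -1, which Fermat's little theorem excludes
    because [(p - 1) / 2] is odd. *)
Lemma sum_sqr_Fp_eq0 p (x y : 'F_p) : prime p -> (p %% 4 = 3)%N ->
  x ^+ 2 + y ^+ 2 = 0 -> x = 0 /\ y = 0.
Proof.
move=> pp p3 h.
have op : odd p by move: p3; lia.
have [y0|yn0] := eqVneq y 0.
  by move: h; rewrite y0 expr0n addr0 => /eqP; rewrite sqrf_eq0 => /eqP.
have h1 : (x / y) ^+ 2 = -1.
  apply/eqP; rewrite -subr_eq0 opprK; apply/eqP.
  by have -> : (x / y) ^+ 2 + 1 = (x ^+ 2 + y ^+ 2) / y ^+ 2; [field | rewrite h mul0r].
have fermat (z : 'F_p) : z ^+ p = z.
  by rewrite -{2}(expf_card z) card_Fp.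
have zn0 : x / y != 0.
  by apply/eqP => z0; move/eqP: h1; rewrite z0 expr0n eq_sym oppr_eq0 oner_eq0.
have : (x / y) ^+ p.-1 = 1.
  apply: (mulfI zn0); rewrite mulr1 -exprS prednK ?fermat //.
  exact: prime_gt0.
have -> : p.-1 = (2 * (p %/ 4).*2.+1)%N by move: p3; lia.
rewrite exprM h1 -signr_odd /= odd_double /= => /eqP.
rewrite -subr_eq0 -opprD oppr_eq0 => /eqP h2.
by case/eqP: (Fp2_neq0 pp op).
Qed.

(** * Rotations modulo a prime power *)

Section Reduction.
Variables (p r : nat).
Hypotheses (pp : prime p) (r1 : (1 <= r)%N).

Definition red (x : 'Z_(p ^ r)%N) : 'F_p := (val x)%:R.

Let n1 : (1 < p ^ r)%N.
Proof. by rewrite -(exp1n r) ltn_exp2r // prime_gt1. Qed.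

Lemma red_nat k : red k%:R = k%:R.
Proof.
rewrite /red /= val_Zp_nat // [in RHS](divn_eq k (p ^ r)) natrD natrM.
by rewrite natrX pchar_Fp_0 // expr0n -[(r == 0)%N]negbK -lt0n r1 mulr0 add0r.
Qed.

Lemma red_additive x y : red (x + y) = red x + red y.
Proof. by rewrite -[x]natr_Zp -[y]natr_Zp -natrD !red_nat natrD. Qed.

Lemma red_multiplicative x y : red (x * y) = red x * red y.
Proof. by rewrite -[x]natr_Zp -[y]natr_Zp -natrM !red_nat natrM. Qed.

Lemma red1 : red 1 = 1. Proof. exact: (red_nat 1). Qed.

Lemma redN x : red (- x) = - red x.
Proof.
apply/eqP; rewrite -subr_eq0 opprK -red_additive addNr.
by rewrite (red_nat 0).
Qed.

Definition redE := (red_additive, red_multiplicative, redN, red1, expr2).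

Lemma red_unit x : red x != 0 -> x \is a GRing.unit.
Proof.
rewrite -[x]natr_Zp red_nat unitZpE // -(dvdn_pcharf (pchar_Fp pp)).
by rewrite coprime_pexpl // prime_coprime.
Qed.

(** The quotient by [p], which is below [p ^ r.-1], separates the elements of a fiber. *)
Lemma card_red_fiber (s : 'F_p) : (#|[set x | red x == s]| <= p ^ r.-1)%N.
Proof.
have lt_div (x : 'Z_(p ^ r)%N) : (val x %/ p < p ^ r.-1)%N.
  rewrite ltn_divLR ?prime_gt0 // -expnSr prednK //.
  by rewrite -[X in (_ < X)%N](Zp_cast n1) ltn_ord.
rewrite -[X in (_ <= X)%N]card_ord.
pose f x : 'I_(p ^ r.-1) := Ordinal (lt_div x).
rewrite -(@card_in_imset _ _ f) ?max_card // => x y.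
rewrite !inE => /eqP hx /eqP hy /(congr1 val) /= hxy; apply: val_inj => /=.
have : nat_of_ord (red x) = red y by rewrite hx hy.
rewrite /red /= !val_Fp_nat // => hm.
by rewrite /= (divn_eq x p) (divn_eq y p) hxy hm.
Qed.

Local Notation n := (p ^ r)%N.

Definition redp (g : 'M['Z_n]_2) : 'F_p * 'F_p := (red (g 0 0), red (g 1 0)).

Lemma SO2E (g : 'M['Z_n]_2) : g \in SO2 n ->
  g = rotmx (g 0 0) (g 1 0) /\ g 0 0 ^+ 2 + g 1 0 ^+ 2 = 1.
Proof. by case/imsetP => -[a b] /= /eqP h ->; rewrite !mxE /=. Qed.

Lemma redp_circle (g : 'M['Z_n]_2) : g \in SO2 n ->
  red (g 0 0) ^+ 2 + red (g 1 0) ^+ 2 = 1.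
Proof. by case/SO2E => _ /(congr1 red); rewrite !redE. Qed.

Hypothesis op : odd p.

(** Uniqueness in Hensel lifting: [x + y] reduces to [2 * red x], so it is a unit, and it kills
    [x - y]. *)
Lemma sqr_red_inj (x y : 'Z_n) :
  red x = red y -> red x != 0 -> x ^+ 2 = y ^+ 2 -> x = y.
Proof.
move=> hr x0 h; apply/eqP; rewrite -subr_eq0; apply/eqP.
have /mulIr : x + y \is a GRing.unit.
  apply: red_unit; rewrite redE -hr -mulr2n -mulr_natl mulf_neq0 //.
  exact: Fp2_neq0.
by apply; rewrite mul0r -subr_sqr h subrr.
Qed.

(** Some coordinate is nonzero mod [p]. By [sqr_red_inj] the other coordinate determines it within
    the fiber, and that other one has a prescribed residue. *)
Lemma card_SO2_fiber (t : 'F_p * 'F_p) :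
  (#|[set g in SO2 n | redp g == t]| <= p ^ r.-1)%N.
Proof.
case: t => t1 t2; have [t10|t10] := eqVneq t1 0.
  rewrite -(@card_in_imset _ _ (fun g : 'M['Z_n]_2 => g 0 0)).
    apply: leq_trans (card_red_fiber t1); apply: subset_leq_card.
    by apply/subsetP => _ /imsetP[g + ->]; rewrite !inE => /andP[_ /andP[]].
  move=> g h; rewrite !inE => /andP[hg /eqP[g1 g2]] /andP[hh /eqP[h1 h2]] e.
  have [eg cg] := SO2E hg; have [eh ch] := SO2E hh.
  rewrite eg eh -e; congr rotmx; apply: sqr_red_inj.
  - by rewrite g2 h2.
  - apply/eqP => g0; move: (redp_circle hg); rewrite g0 g1 t10 expr0n addr0.
    by move/eqP; rewrite eq_sym oner_eq0.
  - by apply: (addrI (g 0 0 ^+ 2)); rewrite cg e ch.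
rewrite -(@card_in_imset _ _ (fun g : 'M['Z_n]_2 => g 1 0)).
  apply: leq_trans (card_red_fiber t2); apply: subset_leq_card.
  by apply/subsetP => _ /imsetP[g + ->]; rewrite !inE => /andP[_ /andP[]].
move=> g h; rewrite !inE => /andP[hg /eqP[g1 g2]] /andP[hh /eqP[h1 h2]] e.
have [eg cg] := SO2E hg; have [eh ch] := SO2E hh.
rewrite eg eh -e; congr rotmx; apply: sqr_red_inj.
- by rewrite g1 h1.
- by rewrite g1.
- by apply: (addIr (g 1 0 ^+ 2)); rewrite cg e ch.
Qed.

Lemma card_SO2 : (#|SO2 n| <= 2 * n)%N.
Proof.
have def_n : n = (p * p ^ r.-1)%N by rewrite -expnS prednK.
rewrite [X in (_ <= _ * X)%N]def_n mulnA -[in X in (_ <= 2 * X * _)%N](card_Fp pp).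
apply: leq_trans (leq_mul (card_circle _) (leqnn _)).
rewrite -[#|SO2 n|]sum1_card (partition_big redp
  (mem [set t : 'F_p * 'F_p | t.1 ^+ 2 + t.2 ^+ 2 == 1])) /=; last first.
  by move=> g hg; rewrite inE /= redp_circle.
rewrite -sum_nat_const; apply: leq_sum => t _.
apply: leq_trans (card_SO2_fiber t); rewrite sum1_card.
by apply: subset_leq_card; apply/subsetP => g; rewrite unfold_in !inE.
Qed.

(** Multiplying by [rotmx a (- b)] gives the scalar [a ^+ 2 + b ^+ 2], which therefore cannot be a
    unit. The entries of [m] may all be divisible by [p], so the conclusion is only mod [p]. *)
Lemma rotmx_kernel (m : 'rV['Z_n]_2) (a b : 'Z_n) :
  m != 0 -> m *m rotmx a b = 0 -> red a ^+ 2 + red b ^+ 2 = 0.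
Proof.
move=> m0 h; apply/eqP; apply: contraNT m0 => nz.
have : a ^+ 2 + b ^+ 2 \is a GRing.unit.
  by apply: red_unit; rewrite !redE.
move=> u; have : m *m rotmx a b *m rotmx a (- b) = 0 by rewrite h mul0mx.
rewrite -mulmxA.
have -> : rotmx a b *m rotmx a (- b) = (a ^+ 2 + b ^+ 2)%:M.
  apply/matrixP => i j; rewrite !mxE !big_ord_recl big_ord0 !mxE.
  by case: i j => [[|[|//]] ?] [[|[|//]] ?] //=; rewrite ?mulr1n ?mulr0n; ring.
rewrite mul_mx_scalar => /(congr1 (fun x => (a ^+ 2 + b ^+ 2)^-1 *: x)).
by rewrite scalerA mulVr // scale1r scaler0 => ->.
Qed.

Lemma rotmx_sum4 (g1 g2 h1 h2 : 'M['Z_n]_2) :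
  g1 \in SO2 n -> g2 \in SO2 n -> h1 \in SO2 n -> h2 \in SO2 n ->
  g1 + g2 - (h1 + h2) = rotmx (g1 0 0 + g2 0 0 - (h1 0 0 + h2 0 0))
                              (g1 1 0 + g2 1 0 - (h1 1 0 + h2 1 0)).
Proof.
move=> /SO2E[-> _] /SO2E[-> _] /SO2E[-> _] /SO2E[-> _].
by apply/matrixP => i j; rewrite !mxE; case: i j => [[|[|//]] ?] [[|[|//]] ?] //=; ring.
Qed.

(** Differences of sums of rotations keep the shape of [rotmx], so a coincidence under [m] yields an
    isotropic vector mod [p]. *)
Lemma mulmx_sum4 (m : 'rV['Z_n]_2) (g1 g2 h1 h2 : 'M['Z_n]_2) :
  m != 0 ->
  g1 \in SO2 n -> g2 \in SO2 n -> h1 \in SO2 n -> h2 \in SO2 n ->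
  m *m (g1 + g2) = m *m (h1 + h2) ->
  (red (g1 0 0) + red (g2 0 0) - (red (h1 0 0) + red (h2 0 0))) ^+ 2 +
  (red (g1 1 0) + red (g2 1 0) - (red (h1 1 0) + red (h2 1 0))) ^+ 2 = 0.
Proof.
move=> m0 G1 G2 H1 H2 /eqP; rewrite -subr_eq0 -mulmxBr rotmx_sum4 // => /eqP.
by move/(rotmx_kernel m0); rewrite !redE.
Qed.

(** Two solutions differ by an isotropic vector mod [p], so [circle_dist0] puts them in one fiber of
    [redp]. *)
Lemma card_orbit_fiber (m v : 'rV['Z_n]_2) (g : 'M['Z_n]_2) :
  m != 0 -> g \in SO2 n ->
  (#|[set h in SO2 n | m *m (g + h) == v]| <= p ^ r.-1)%N.
Proof.
move=> m0 gG; set S := [set h in _ | _].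
have [h hS|S0] := pickP (mem S); last by rewrite eq_card0.
apply: leq_trans (card_SO2_fiber (redp h)); apply: subset_leq_card.
apply/subsetP => h'; move: hS; rewrite !inE.
move=> /andP[hG /eqP hv] /andP[hG' /eqP hv']; rewrite hG' /=; apply/eqP.
apply: circle_dist0; rewrite ?redp_circle //; first exact: Fp2_neq0.
have := @mulmx_sum4 m g h' g h m0 gG hG' gG hG.
by rewrite hv hv' !opprD !addrA ![_ + red (h' _ _) - red (g _ _)]addrAC !subrr !add0r => ->.
Qed.

Lemma card_opposite_fiber (g : 'M['Z_n]_2) :
  (#|[set h in SO2 n | (red (g 0 0) + red (h 0 0) == 0)%R &&
                        (red (g 1 0) + red (h 1 0) == 0)%R]| <= p ^ r.-1)%N.
Proof.
apply: leq_trans (card_SO2_fiber (- red (g 0 0), - red (g 1 0))).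
apply: subset_leq_card; apply/subsetP => h; rewrite !inE => /andP[-> /=].
by rewrite -pair_eqE /= /pair_eq /= -!addr_eq0 ![_ + red (g _ _)]addrC.
Qed.

(** The only isotropic vector mod [p] is 0, so all these pairs share one nonzero sum mod [p], and
    [circle_sum_unique] fixes the unordered pair of residues. The factor 2 counts its orderings. *)
Lemma card_pairs_3mod4 (m v : 'rV['Z_n]_2) : (p %% 4 = 3)%N -> m != 0 ->
  (#|[set q in setX (SO2 n) (SO2 n) |
      ~~ ((red (q.1 0 0) + red (q.2 0 0) == 0)%R &&
          (red (q.1 1 0) + red (q.2 1 0) == 0)%R) &&
      (m *m (q.1 + q.2) == v)%R]| <= 2 * (p ^ r.-1) ^ 2)%N.
Proof.
move=> p3 m0; set S := [set q in _ | _].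
have [[h1 h2] hS|S0] := pickP (mem S); last by rewrite eq_card0.
pose Fb h := [set g in SO2 n | redp g == redp h].
have FbS : S \subset setX (Fb h1) (Fb h2) :|: setX (Fb h2) (Fb h1).
  apply/subsetP => -[g1 g2]; move: hS; rewrite !inE /=.
  move=> /andP[/andP[H1 H2] /andP[hn /eqP hv]].
  move=> /andP[/andP[G1 G2] /andP[gn /eqP gv]].
  rewrite G1 G2 /=.
  have [] := @sum_sqr_Fp_eq0 p _ _ pp p3 (mulmx_sum4 m0 G1 G2 H1 H2 _).
    by rewrite hv gv.
  move/subr0_eq => e0 /subr0_eq e1.
  have g20 : red (g2 0 0) = red (h1 0 0) + red (h2 0 0) - red (g1 0 0).
    by rewrite -e0 addrAC subrr add0r.
  have g21 : red (g2 1 0) = red (h1 1 0) + red (h2 1 0) - red (g1 1 0).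
    by rewrite -e1 addrAC subrr add0r.
  have [] := @circle_sum_unique _ (Fp2_neq0 pp op) _ _ _ _
    (red (g1 0 0)) (red (g1 1 0)) (redp_circle H1) (redp_circle H2)
    (redp_circle G1) _ _.
  - by rewrite -g20 -g21 redp_circle.
  - apply: contra hn => /eqP /(sum_sqr_Fp_eq0 pp p3)[-> ->].
    by rewrite eqxx.
  - move=> [a b]; rewrite /redp g20 g21 a b.
    by rewrite ![red (h1 _ _) + _ - _]addrAC !subrr !add0r !eqxx.
  - move=> [a b]; rewrite /redp g20 g21 a b.
    by rewrite !addrK !eqxx orbT.
apply: leq_trans (subset_leq_card FbS) _; apply: leq_trans (leq_card_setU _ _) _.
rewrite mul2n -addnn !cardsX -mulnn.
by apply: leq_add; apply: leq_mul; apply: card_SO2_fiber.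
Qed.

End Reduction.

(** * Additive energy *)

Section Energy.
Variable C : numFieldType.

(** Cauchy-Schwarz against the constant 1. Nonnegativity makes [a i - a j] real, so that its square
    is nonnegative in a [numFieldType]. *)
Lemma ler_sqr_sum (I : finType) (P : pred I) (a : I -> C) :
  (forall i, 0 <= a i) ->
  (\sum_(i | P i) a i) ^+ 2 <= #|P|%:R * \sum_(i | P i) a i ^+ 2.
Proof.
move=> a0.
have -> : #|P|%:R * (\sum_(i | P i) a i ^+ 2) =
   \sum_(i | P i) \sum_(j | P j) ((a i ^+ 2 + a j ^+ 2) / 2).
  have inner i : \sum_(j | P j) ((a i ^+ 2 + a j ^+ 2) / 2) =
      (#|P|%:R * a i ^+ 2 + \sum_(j | P j) a j ^+ 2) / 2.
    by rewrite -mulr_suml big_split /= sumr_const mulr_natl.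
  rewrite [RHS](eq_bigr _ (fun i _ => inner i)) -mulr_suml big_split /= sumr_const -mulr_sumr !mulr_natl.
  by rewrite -mulr2n -[_ *+ 2]mulr_natr mulfK ?pnatr_eq0.
rewrite expr2 mulr_suml; apply: ler_sum => i _.
rewrite mulr_sumr; apply: ler_sum => j _.
rewrite ler_pdivlMr ?ltr0n // -subr_ge0.
have -> : a i ^+ 2 + a j ^+ 2 - a i * a j * 2 = (a i - a j) ^+ 2 by ring.
by rewrite -realEsqr realB // ger0_real.
Qed.

Lemma sum_sqr_ler (I : finType) (a : I -> C) :
  (forall i, 0 <= a i) -> \sum_i a i ^+ 2 <= (\sum_i a i) ^+ 2.
Proof.
move=> a0; rewrite expr2 mulr_suml; apply: ler_sum => i _.
rewrite expr2 ler_wpM2l // (bigD1 i) //= lerDl sumr_ge0 //.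
Qed.

Variables (T V : finType) (G : {set T}) (phi : T * T -> V) (u : T -> C).
Hypothesis u0 : forall g, 0 <= u g.

(** Expanding the square gives a weighted count of the pairs [q], [q'] in [Q] with
    [phi q = phi q']. *)
Definition energy (Q : {set T * T}) : C :=
  \sum_v (\sum_(q in Q | phi q == v) (u q.1 * u q.2)) ^+ 2.

Let S := \sum_(g in G) u g ^+ 2.

(** Cauchy-Schwarz on each fiber of [phi]; then [Q] is enlarged to [setX G G], where the sum of
    squares factors as [S ^+ 2]. *)
Lemma energy_le_mult (Q : {set T * T}) (M : nat) : Q \subset setX G G ->
  (forall v, (#|[set q in Q | phi q == v]| <= M)%N) ->
  energy Q <= M%:R * S ^+ 2.
Proof.
move=> QG QM.
have -> : S ^+ 2 = \sum_(q in setX G G) (u q.1 * u q.2) ^+ 2.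
  rewrite /S expr2 mulr_suml; under eq_bigr do rewrite mulr_sumr.
  rewrite pair_big /=.
  by apply: eq_big => [[g h]|[g h] _]; rewrite ?inE ?exprMn.
apply: (@le_trans _ _ (M%:R * \sum_(q in Q) (u q.1 * u q.2) ^+ 2)).
  rewrite (partition_big phi predT) //= mulr_sumr; apply: ler_sum => v _.
  apply: le_trans (ler_sqr_sum _ _) _; first by move=> q; rewrite mulr_ge0.
  apply: ler_wpM2r; first by apply: sumr_ge0 => q _; rewrite exprn_ge0 ?mulr_ge0.
  rewrite ler_nat; apply: leq_trans (QM v).
  by apply: subset_leq_card; apply/subsetP => q; rewrite !inE.
apply: ler_wpM2l => //.
rewrite [leRHS](big_setID Q) /= (setIidPr QG) lerDl sumr_ge0 // => q _.
by rewrite exprn_ge0 ?mulr_ge0.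
Qed.

Lemma sum_slices (Q : {set T * T}) (F : T -> T -> C) :
  \sum_(q in Q) F q.1 q.2 = \sum_g \sum_(h | (g, h) \in Q) F g h.
Proof. by rewrite pair_big_dep /=; apply: eq_bigl => -[g h]. Qed.

(** Schur's test: the energy is at most the square of the total mass on [Q], and the inequality of
    means bounds that mass by sums over slices. *)
Lemma energy_le_slices (Q : {set T * T}) (k : nat) : Q \subset setX G G ->
  (forall g, (#|[set h | (g, h) \in Q]| <= k)%N) ->
  (forall h, (#|[set g | (g, h) \in Q]| <= k)%N) ->
  energy Q <= (k ^ 2)%:R * S ^+ 2.
Proof.
move=> QG Q1 Q2.
apply: le_trans (sum_sqr_ler _) _.
  by move=> v; apply: sumr_ge0 => q _; rewrite mulr_ge0.
rewrite -(partition_big phi predT) //= natrX -exprMn ler_sqr ?nnegrE; last 2 first.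
- by apply: sumr_ge0 => q _; rewrite mulr_ge0.
- by rewrite mulr_ge0 //; apply: sumr_ge0 => q _; rewrite exprn_ge0.
(* The indicator of [D], used with [D = G], makes the bound vanish where the slice is empty, so that
   summing over all [g] gives [S]. *)
have slice (A : {set T}) g (D : {set T}) : (forall h, h \in A -> g \in D) ->
    (#|A| <= k)%N -> \sum_(h in A) u g ^+ 2 <= k%:R * (u g ^+ 2 *+ (g \in D)).
  move=> AD Ak; rewrite sumr_const.
  case: (set_0Vmem A) => [->|[h hA]].
    by rewrite cards0 mulr0n mulr_ge0 // mulrn_wge0 // exprn_ge0.
  rewrite (AD _ hA) mulr1n -[leLHS]mulr_natl ler_wpM2r ?ler_nat //.
  by rewrite exprn_ge0.
have SE : S = \sum_g u g ^+ 2 *+ (g \in G).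
  by rewrite /S big_mkcond /=; apply: eq_bigr => g _; case: (g \in G).
have le1 : \sum_(q in Q) u q.1 ^+ 2 <= k%:R * S.
  rewrite (sum_slices Q (fun g _ => u g ^+ 2)) SE mulr_sumr.
  apply: ler_sum => g _.
  rewrite (eq_bigl (fun h => h \in [set h | (g, h) \in Q])); last first.
    by move=> h; rewrite inE.
  apply: slice (Q1 g) => h.
  by rewrite inE => /(subsetP QG); rewrite inE => /andP[].
have le2 : \sum_(q in Q) u q.2 ^+ 2 <= k%:R * S.
  rewrite (sum_slices Q (fun _ h => u h ^+ 2)) SE mulr_sumr.
  rewrite (exchange_big_dep predT) //=; apply: ler_sum => h _.
  rewrite (eq_bigl (fun g => g \in [set g | (g, h) \in Q])); last first.
    by move=> g; rewrite inE.
  apply: slice (Q2 h) => g.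
  by rewrite inE => /(subsetP QG); rewrite inE => /andP[].
apply: (@le_trans _ _ (\sum_(q in Q) ((u q.1 ^+ 2 + u q.2 ^+ 2) / 2))).
  apply: ler_sum => q _; rewrite ler_pdivlMr ?ltr0n // -subr_ge0.
  have -> : u q.1 ^+ 2 + u q.2 ^+ 2 - u q.1 * u q.2 * 2 = (u q.1 - u q.2) ^+ 2
    by ring.
  by rewrite -realEsqr realB // ger0_real.
rewrite -mulr_suml big_split /= ler_pdivrMr ?ltr0n //.
have -> : k%:R * S * 2 = k%:R * S + k%:R * S by ring.
exact: lerD.
Qed.

(** Lets two kinds of pairs be bounded by different methods; for each [v] this is
    [(x + y) ^+ 2 <= 2 * x ^+ 2 + 2 * y ^+ 2]. *)
Lemma energy_split (Q Q' : {set T * T}) :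
  energy Q <= 2 * energy (Q :&: Q') + 2 * energy (Q :\: Q').
Proof.
rewrite /energy !mulr_sumr -big_split /=; apply: ler_sum => v _.
rewrite (bigID (mem Q')) /=.
under eq_bigl => q do rewrite andbAC -in_setI.
under [X in (_ + X) ^+ 2]eq_bigl => q do
  rewrite andbAC [(q \in Q) && _]andbC -in_setD.
set x := \sum_(_ in _ | _) _; set y := \sum_(_ in _ | _) _.
have x0 : 0 <= x by apply: sumr_ge0 => q _; rewrite mulr_ge0.
have y0 : 0 <= y by apply: sumr_ge0 => q _; rewrite mulr_ge0.
rewrite -subr_ge0.
have -> : 2 * x ^+ 2 + 2 * y ^+ 2 - (x + y) ^+ 2 = (x - y) ^+ 2 by ring.
by rewrite -realEsqr realB // ger0_real.
Qed.

End Energy.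

(** * Energy of the orbit of a nonzero frequency *)

Section RotationEnergy.
Variables (C : numFieldType) (p r : nat).
Hypotheses (pp : prime p) (op : odd p) (r1 : (1 <= r)%N).
Variables (m : 'rV['Z_(p ^ r)%N]_2) (u : 'M['Z_(p ^ r)%N]_2 -> C).
Hypotheses (m0 : m != 0) (u0 : forall g, 0 <= u g).
Local Notation n := (p ^ r)%N.
Local Notation G := (SO2 n).
Local Notation phi := (fun q : 'M['Z_n]_2 * 'M['Z_n]_2 => m *m (q.1 + q.2)).

(** The first rotation has at most [2 * n] choices, and each leaves at most [p ^ r.-1] choices for
    the second. *)
Lemma energy_SO2 :
  energy phi u (setX G G) <=
  (2 * n * p ^ r.-1)%:R * (\sum_(g in G) u g ^+ 2) ^+ 2.
Proof.
apply: energy_le_mult => // v; set Q := [set q in _ | _].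
rewrite -sum1_card (partition_big fst (mem G)) /=; last first.
  by move=> q; rewrite !inE => /andP[/andP[]].
apply: leq_trans (leq_mul (card_SO2 pp r1 op) (leqnn _)).
rewrite -sum_nat_const; apply: leq_sum => g gG.
apply: leq_trans (card_orbit_fiber pp r1 op v m0 gG).
rewrite sum1_card -(@card_in_imset _ _ snd).
  apply: subset_leq_card; apply/subsetP => _ /imsetP[q + ->].
  rewrite -topredE /= !inE => /andP[/andP[/andP[_ ->] hv] /eqP <-].
  by rewrite hv.
move=> [a b] [c d]; rewrite -!topredE /= => /andP[_ /eqP->] /andP[_ /eqP->].
by move=> /= ->.
Qed.

Lemma energy_SO2_3mod4 : (p %% 4 = 3)%N ->
  energy phi u (setX G G) <=
  (6 * (p ^ r.-1) ^ 2)%:R * (\sum_(g in G) u g ^+ 2) ^+ 2.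
Proof.
move=> p3.
(* Pairs with opposite reductions: their sum is 0 mod [p] and does not determine them, so they go to
   Schur's test. *)
pose Q' := [set q : 'M['Z_n]_2 * 'M['Z_n]_2 |
  (red (q.1 0 0) + red (q.2 0 0) == 0) && (red (q.1 1 0) + red (q.2 1 0) == 0)].
apply: le_trans (energy_split _ u0 _ Q') _.
set S := \sum_(g in G) _.
have e1 : energy phi u (setX G G :&: Q') <= ((p ^ r.-1) ^ 2)%:R * S ^+ 2.
  apply: energy_le_slices => //; first exact: subsetIl.
    move=> g; apply: leq_trans (card_opposite_fiber pp r1 op g).
    by apply: subset_leq_card; apply/subsetP => h; rewrite !inE => /andP[/andP[_ ->]].
  move=> g; apply: leq_trans (card_opposite_fiber pp r1 op g).
  apply: subset_leq_card; apply/subsetP => h; rewrite !inE.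
  by move=> /andP[/andP[-> _]] /=; rewrite ![red (h _ _) + _]addrC.
have e2 : energy phi u (setX G G :\: Q') <= (2 * (p ^ r.-1) ^ 2)%:R * S ^+ 2.
  apply: energy_le_mult => //; first exact: subsetDl.
  move=> v; apply: leq_trans (card_pairs_3mod4 pp r1 op v p3 m0).
  apply: subset_leq_card; apply/subsetP => q; rewrite !inE.
  by move=> /andP[/andP[-> ->] ->].
(* The constant is 6 = 2 * 1 + 2 * 2. *)
have := lerD (ler_wpM2l (ler0n C 2) e1) (ler_wpM2l (ler0n C 2) e2).
move/le_trans; apply.
by rewrite !natrM le_eqVlt; apply/orP; left; apply/eqP; ring.
Qed.

End RotationEnergy.

(** * Fourier analysis on pairs of residues *)

Lemma parseval (C : numClosedFieldType) (I J : finType) (chi : I -> J -> C)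
    (N : C) (c : I -> C) :
  (forall i i', \sum_j chi i j * (chi i' j)^* = N *+ (i == i')) ->
  \sum_j `|\sum_i c i * chi i j| ^+ 2 = N * \sum_i `|c i| ^+ 2.
Proof.
move=> orth.
transitivity (\sum_i \sum_i' (c i * (c i')^*) * (N *+ (i == i'))).
  have expand j : `|\sum_i c i * chi i j| ^+ 2 =
      \sum_i \sum_i' (c i * chi i j) * (c i' * chi i' j)^*.
    rewrite normCK rmorph_sum /= mulr_suml.
    by apply: eq_bigr => i _; rewrite mulr_sumr.
  rewrite (eq_bigr _ (fun j _ => expand j)) exchange_big /=; apply: eq_bigr => i _.
  rewrite exchange_big /=; apply: eq_bigr => i' _.
  rewrite -orth mulr_sumr; apply: eq_bigr => j _.
  by rewrite rmorphM /=; ring.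
rewrite mulr_sumr; apply: eq_bigr => i _.
rewrite (bigD1 i) //= eqxx mulr1n big1 ?addr0 => [|i' ne].
  by rewrite normCK mulrC.
by rewrite eq_sym (negPf ne) mulr0n mulr0.
Qed.

(** Translation by [x0] permutes the terms and multiplies the sum by [f x0]. *)
Lemma sum_character_eq0 (V : finZmodType) (C : idomainType) (f : V -> C) x0 :
  (forall x y, f (x + y) = f x * f y) -> f x0 != 1 -> \sum_x f x = 0.
Proof.
move=> fD fx0; apply/eqP.
have : f x0 * (\sum_x f x) - \sum_x f x = 0.
  rewrite [X in _ - X](reindex_inj (addrI x0)) mulr_sumr.
  by apply/eqP; rewrite subr_eq0; apply/eqP; apply: eq_bigr => x _; rewrite fD.
move/eqP; rewrite -{2}[\sum_x f x]mul1r -mulrBl mulf_eq0 subr_eq0.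
by rewrite (negPf fx0).
Qed.

(** * Additive characters and their orthogonality *)

Section Characters.
Variables (n : nat) (z : algC).
Hypotheses (n1 : (1 < n)%N) (zn : n.-primitive_root z).

Definition expZ (a : 'Z_n) : algC := z ^+ a.

Lemma expZD a b : expZ (a + b) = expZ a * expZ b.
Proof.
rewrite /expZ -exprD -(prim_expr_mod zn (a + b)) /=.
by rewrite [X in (_ %% X)%N]Zp_cast.
Qed.

Lemma expZ_eq1 a : (expZ a == 1) = (a == 0).
Proof.
rewrite /expZ -(prim_order_dvd zn) /dvdn modn_small //.
by have := ltn_ord a; rewrite [X in (_ < X)%N]Zp_cast.
Qed.

Lemma expZ_conj a : (expZ a)^* = expZ (- a).
Proof.
have h : expZ a * expZ (- a) = 1.
  by rewrite -expZD subrr; apply/eqP; rewrite expZ_eq1.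
have nz : `|z| = 1.
  apply/eqP; rewrite -(@pexpr_eq1 _ _ n) ?normr_ge0 //; last exact: ltnW.
  by rewrite -normrX prim_expr_order // normr1.
have ne0 : expZ a != 0.
  by apply/eqP => a0; move/eqP: h; rewrite a0 mul0r eq_sym oner_eq0.
by apply: (mulfI ne0); rewrite h -normCK /expZ normrX nz !expr1n.
Qed.

(** Frequencies are rows and points are columns, so rotations act on frequencies from the right and
    move across the pairing. *)
Definition chi (m : 'rV['Z_n]_2) (x : 'cV['Z_n]_2) : algC :=
  expZ ((m *m x) 0 0).

Lemma chiDl m m' x : chi (m + m') x = chi m x * chi m' x.
Proof. by rewrite /chi mulmxDl mxE expZD. Qed.

Lemma chiDr m x y : chi m (x + y) = chi m x * chi m y.
Proof. by rewrite /chi mulmxDr mxE expZD. Qed.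

Lemma chi_conjl m x : (chi m x)^* = chi (- m) x.
Proof. by rewrite /chi expZ_conj mulNmx [in RHS]mxE. Qed.

Lemma chi_conjr m x : (chi m x)^* = chi m (- x).
Proof. by rewrite /chi expZ_conj mulmxN [in RHS]mxE. Qed.

Lemma chi0l x : chi 0 x = 1.
Proof. by apply/eqP; rewrite /chi mul0mx mxE expZ_eq1. Qed.

Lemma chi0r m : chi m 0 = 1.
Proof. by apply/eqP; rewrite /chi mulmx0 mxE expZ_eq1. Qed.

Lemma chi_mul m g x : chi (m *m g) x = chi m (g *m x).
Proof. by rewrite /chi mulmxA. Qed.

Lemma sum_chi_r m : \sum_x chi m x = (n ^ 2)%:R *+ (m == 0).
Proof.
have [->|m0] := eqVneq m 0.
  under eq_bigr do rewrite chi0l.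
  by rewrite sumr_const card_mx card_ord Zp_cast.
have [i mi] : exists i, m 0 i != 0.
  apply/existsP; apply: contraNT m0; rewrite negb_exists => /forallP m00.
  by apply/eqP/rowP => i; rewrite mxE; apply/eqP; have := m00 i; rewrite negbK.
rewrite mulr0n; apply: (@sum_character_eq0 _ _ _ (delta_mx i 0)) => [x y|].
  exact: chiDr.
by rewrite /chi -colE mxE expZ_eq1.
Qed.

Lemma sum_chi_l x : \sum_m chi m x = (n ^ 2)%:R *+ (x == 0).
Proof.
have [->|x0] := eqVneq x 0.
  under eq_bigr do rewrite chi0r.
  by rewrite sumr_const card_mx card_ord Zp_cast.
have [i xi] : exists i, x i 0 != 0.
  apply/existsP; apply: contraNT x0; rewrite negb_exists => /forallP x00.
  by apply/eqP/colP => i; rewrite mxE; apply/eqP; have := x00 i; rewrite negbK.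
rewrite mulr0n; apply: (@sum_character_eq0 _ _ _ (delta_mx 0 i)) => [m m'|].
  exact: chiDl.
by rewrite /chi -rowE mxE expZ_eq1.
Qed.

Lemma chi_orth_r m m' :
  \sum_x chi m x * (chi m' x)^* = (n ^ 2)%:R *+ (m == m').
Proof.
under eq_bigr do rewrite chi_conjl -chiDl.
by rewrite sum_chi_r subr_eq0.
Qed.

Lemma chi_orth_l x y :
  \sum_m chi m x * (chi m y)^* = (n ^ 2)%:R *+ (x == y).
Proof.
under eq_bigr do rewrite chi_conjr -chiDr.
by rewrite sum_chi_l subr_eq0.
Qed.

Definition hat (B : {set 'cV['Z_n]_2}) m : algC := \sum_(y in B) chi m y.

Lemma sum_hat_sqr B : \sum_m `|hat B m| ^+ 2 = (n ^ 2)%:R * #|B|%:R.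
Proof.
transitivity (\sum_m `|\sum_x (x \in B)%:R * chi m x| ^+ 2).
  apply: eq_bigr => m _; congr (`| _ | ^+ 2).
  rewrite /hat big_mkcond /=; apply: eq_bigr => x _.
  by case: (x \in B); rewrite ?mul1r ?mul0r.
rewrite (@parseval _ _ _ (fun x m => chi m x) _ _ chi_orth_l).
congr (_ * _); rewrite -sum1_card natr_sum [RHS]big_mkcond /=.
by apply: eq_bigr => x _; case: (x \in B); rewrite ?normr1 ?normr0 ?expr1n ?expr0n.
Qed.

(** * Restriction estimate on the orbit of a frequency *)

Section Restriction.
Variables (G : {set 'M['Z_n]_2}) (B : {set 'cV['Z_n]_2}) (m : 'rV['Z_n]_2).
Variable M : nat.
Hypothesis energyM : forall u : 'M['Z_n]_2 -> algC, (forall g, 0 <= u g) ->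
  energy (fun q : 'M['Z_n]_2 * 'M['Z_n]_2 => m *m (q.1 + q.2)) u (setX G G)
  <= M%:R * (\sum_(g in G) u g ^+ 2) ^+ 2.

Let f g : algC := (hat B (m *m g))^*.
(** The extension operator dual to restricting [hat B] to the orbit of [m], applied to the weight
    [f] that makes its sum over [B] equal to [S]. *)
Let F y : algC := \sum_(g in G) f g * chi (m *m g) y.
Let S : algC := \sum_(g in G) `|hat B (m *m g)| ^+ 2.

Let S_ge0 : 0 <= S.
Proof. by apply: sumr_ge0 => g _; rewrite exprn_ge0. Qed.

Let sumF : S = \sum_(y in B) F y.
Proof.
rewrite /F exchange_big /=; apply: eq_bigr => g _.
by rewrite -mulr_sumr normCK mulrC.
Qed.

(** The square of [F] is a Fourier series whose coefficient at [v] collects the pairs with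
    [m *m (g + h) = v], so Parseval bounds the fourth moment by an energy. *)
Let F4 : \sum_y `|F y| ^+ 4 <= (n ^ 2)%:R * (M%:R * S ^+ 2).
Proof.
pose c v := \sum_(q in setX G G | m *m (q.1 + q.2) == v) (f q.1 * f q.2).
have F2 y : F y ^+ 2 = \sum_v c v * chi v y.
  transitivity (\sum_(q in setX G G) (f q.1 * f q.2 * chi (m *m (q.1 + q.2)) y)).
    rewrite /F expr2 mulr_suml; under eq_bigr do rewrite mulr_sumr.
    rewrite pair_big /=; apply: eq_big => [[g h]|[g h] _] /=; first by rewrite inE.
    by rewrite mulmxDr chiDl; ring.
  rewrite (partition_big (fun q => m *m (q.1 + q.2)) predT) //=.
  apply: eq_bigr => v _; rewrite mulr_suml.
  by apply: eq_bigr => q /andP[_ /eqP ->].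
have -> : \sum_y `|F y| ^+ 4 = \sum_y `|\sum_v c v * chi v y| ^+ 2.
  by apply: eq_bigr => y _; rewrite -F2 normrX -exprM.
rewrite (parseval c chi_orth_r); apply: ler_wpM2l => //.
have := energyM (fun g => normr_ge0 (f g)).
have -> : \sum_(g in G) `|f g| ^+ 2 = S.
  by apply: eq_bigr => g _; rewrite /f norm_conjC.
apply: le_trans; apply: ler_sum => v _.
rewrite ler_sqr ?nnegrE //; last by apply: sumr_ge0 => q _; rewrite mulr_ge0.
apply: le_trans (ler_norm_sum _ _ _) _; apply: ler_sum => q _.
by rewrite normrM.
Qed.

(** Hölder's inequality is obtained by applying Cauchy-Schwarz twice; [F4] then bounds [S ^+ 4] by a
    multiple of [S ^+ 2], which is cancelled when [S] is nonzero. *)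
Lemma restriction_bound : S ^+ 2 <= (#|B| ^ 3 * n ^ 2 * M)%:R.
Proof.
have [S0|S0] := eqVneq S 0; first by rewrite S0 expr0n.
have S1 : S <= \sum_(y in B) `|F y|.
  by rewrite -[S]ger0_norm // sumF ler_norm_sum.
have B0 : 0 <= #|B|%:R :> algC by [].
have Fnn k : 0 <= \sum_(y in B) `|F y| ^+ k.
  by apply: sumr_ge0 => y _; rewrite exprn_ge0.
have S2 : S ^+ 2 <= #|B|%:R * \sum_(y in B) `|F y| ^+ 2.
  apply: le_trans (ler_sqr_sum (mem B) (fun y => normr_ge0 (F y))).
  by rewrite ler_sqr ?nnegrE // sumr_ge0.
have S4 : (\sum_(y in B) `|F y| ^+ 2) ^+ 2 <= #|B|%:R * \sum_y `|F y| ^+ 4.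
  apply: le_trans (ler_sqr_sum (mem B) (fun y => exprn_ge0 2 (normr_ge0 (F y)))) _.
  apply: ler_wpM2l => //; rewrite [leRHS](bigID (mem B)) /=.
  under eq_bigr do rewrite -exprM.
  by rewrite lerDl sumr_ge0 // => y _; rewrite exprn_ge0.
have : S ^+ 2 * S ^+ 2 <= (#|B| ^ 3 * n ^ 2 * M)%:R * S ^+ 2.
  have S22 : (S ^+ 2) ^+ 2 <= (#|B|%:R * \sum_(y in B) `|F y| ^+ 2) ^+ 2.
    by rewrite ler_sqr ?nnegrE // ?exprn_ge0 ?mulr_ge0.
  rewrite -expr2; apply: le_trans S22 _; rewrite exprMn.
  have := ler_wpM2l (exprn_ge0 2 B0) S4; move/le_trans; apply.
  have := ler_wpM2l (exprn_ge0 3 B0) F4.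
  have -> : (#|B| ^ 3 * n ^ 2 * M)%:R = #|B|%:R ^+ 3 * ((n ^ 2)%:R * M%:R) :> algC.
    by rewrite -natrX -!natrM mulnA.
  by rewrite !mulrA [#|B|%:R ^+ 3]exprSr.
by rewrite ler_pM2r // exprn_gt0 // lt_def S0.
Qed.

End Restriction.

(** * Discrepancy of the incidence count *)

Section Incidences.
Variables (A B : {set 'cV['Z_n]_2}) (G : {set 'M['Z_n]_2}) (M : nat).
Variable R : {set 'M['Z_n]_2 * 'cV['Z_n]_2}.
Hypothesis RG : R \subset setX G [set: 'cV['Z_n]_2].
Hypothesis energyM : forall m : 'rV['Z_n]_2, m != 0 ->
  forall u : 'M['Z_n]_2 -> algC, (forall g, 0 <= u g) ->
  energy (fun q : 'M['Z_n]_2 * 'M['Z_n]_2 => m *m (q.1 + q.2)) u (setX G G)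
  <= M%:R * (\sum_(g in G) u g ^+ 2) ^+ 2.

Let N : algC := (n ^ 2)%:R.
Let cnt (t : 'M['Z_n]_2 * 'cV['Z_n]_2) : nat :=
  #|[set q in setX A B | t.1 *m q.2 + t.2 == q.1]|.
Let D t : algC := N * (cnt t)%:R - #|A|%:R * #|B|%:R.

(** Orthogonality detects [g *m y + w = x], and the zero frequency contributes exactly the product
    of cardinals that [D] subtracts. *)
Let DE g w : D (g, w) =
  \sum_m ((hat A m)^* * hat B (m *m g) *+ (m != 0)) * chi m w.
Proof.
have full : \sum_m (hat A m)^* * hat B (m *m g) * chi m w =
    N * (cnt (g, w))%:R.
  transitivity (\sum_(x in A) \sum_(y in B) \sum_m chi m (g *m y + w - x)).
    have expand m : (hat A m)^* * hat B (m *m g) * chi m w =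
        \sum_(x in A) \sum_(y in B) chi m (g *m y + w - x).
      rewrite /hat rmorph_sum /= -mulrA mulr_suml; apply: eq_bigr => x _.
      rewrite mulr_suml mulr_sumr; apply: eq_bigr => y _.
      by rewrite chi_conjr !chiDr chi_mul; ring.
    rewrite (eq_bigr _ (fun m _ => expand m)) exchange_big /=.
    by apply: eq_bigr => x _; rewrite exchange_big.
  under eq_bigr do under eq_bigr do rewrite sum_chi_l subr_eq0.
  rewrite pair_big /= /cnt -sum1_card natr_sum mulr_sumr.
  rewrite [RHS]big_mkcond [LHS]big_mkcond /=; apply: eq_bigr => -[x y] _.
  rewrite !inE /=; case: (x \in A) => //=; case: (y \in B) => //=.
  by case: eqP => _; rewrite ?mulr1.
rewrite /D -full (bigD1 0) //= [RHS](bigD1 0) //= eqxx mulr0n mul0r add0r.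
have hat0 X : hat X 0 = #|X|%:R.
  rewrite /hat -sum1_card natr_sum; apply: eq_bigr => x _; exact: chi0l.
rewrite mul0mx chi0l !hat0 rmorph_nat mulr1 addrAC subrr add0r.
by apply: eq_bigr => m ->.
Qed.

(** Parseval in the translation, the restriction bound at each nonzero [m], then Parseval for
    [hat A]. Each use of Parseval gives one factor [N]. *)
Let sumD2 :
  \sum_(t in setX G [set: 'cV['Z_n]_2]) `|D t| ^+ 2 <=
  N ^+ 2 * #|A|%:R * sqrtC (#|B| ^ 3 * n ^ 2 * M)%:R.
Proof.
have -> : \sum_(t in setX G [set: 'cV['Z_n]_2]) `|D t| ^+ 2 =
  N * \sum_m ((`|hat A m| ^+ 2 * \sum_(g in G) `|hat B (m *m g)| ^+ 2) *+ (m != 0)).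
  transitivity (\sum_(g in G) \sum_w `|D (g, w)| ^+ 2).
    by rewrite pair_big /=; apply: eq_big => [[g w]|[g w] _] //; rewrite !inE andbT.
  under eq_bigr => g _.
    under eq_bigr do rewrite DE.
    rewrite (parseval _ chi_orth_r).
    over.
  rewrite -mulr_sumr exchange_big /=; congr (_ * _); apply: eq_bigr => m _.
  case: (m != 0); last by rewrite big1 // => g _; rewrite normr0 expr0n.
  rewrite mulr1n mulr_sumr; apply: eq_bigr => g _.
  by rewrite mulr1n normrM norm_conjC exprMn.
set H := sqrtC _.
have H0 : 0 <= H by rewrite sqrtC_ge0.
rewrite [N ^+ 2]expr2 -!mulrA; apply: ler_wpM2l; first exact: ler0n.
rewrite mulrA -sum_hat_sqr mulr_suml; apply: ler_sum => m _.
have [_|m0] := eqVneq m 0; first by rewrite mulr0n mulr_ge0 ?exprn_ge0.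
rewrite mulr1n; apply: ler_wpM2l; first by rewrite exprn_ge0.
rewrite -ler_sqr ?nnegrE //; last by apply: sumr_ge0 => g _; rewrite exprn_ge0.
by rewrite sqrtCK; apply: restriction_bound => u u0; apply: energyM.
Qed.

Lemma incidence_count : incidences (setX A B) R = (\sum_(t in R) cnt t)%N.
Proof.
transitivity (\sum_(t in R)
    \sum_(q in [set q in setX A B | (t.1 *m q.2 + t.2 == q.1)%R]) 1)%N.
  rewrite pair_big_dep /incidences -sum1_card; apply: eq_bigl.
  by move=> [[g w] [x y]]; rewrite !inE /= -andbA.
by apply: eq_bigr => t _; rewrite sum1_card.
Qed.

(** The factor [n ^ 2] and the fourth power clear denominators and roots, so this integer inequality
    can pass from [algC] to the reals. In [n ^ 10], [n ^ 8] is [N ^+ 4] and [n ^ 2] comes from under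
    the root. *)
Lemma incidence_bound :
  ((n ^ 2 * incidences (setX A B) R)%:Z - (#|A| * #|B| * #|R|)%:Z) ^+ 4 <=
  (n ^ 10 * #|R| ^ 2 * #|A| ^ 2 * #|B| ^ 3 * M)%:Z.
Proof.
rewrite -(ler_int algC) rmorphXn /= rmorphB /= -!pmulrn.
set T := _ - _.
have TE : T = \sum_(t in R) D t.
  rewrite /D big_split /= -mulr_sumr sumrN sumr_const /T incidence_count.
  congr (_ - _); first by rewrite natrM natr_sum.
  by rewrite -[RHS]mulr_natr -!natrM.
have Tr : T \is Num.real by rewrite /T realB ?realn.
have T2 : T ^+ 2 <= #|R|%:R * (N ^+ 2 * #|A|%:R * sqrtC (#|B| ^ 3 * n ^ 2 * M)%:R).
  rewrite -real_normK //.
  apply: (@le_trans _ _ ((\sum_(t in R) `|D t|) ^+ 2)).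
    rewrite ler_sqr ?nnegrE ?normr_ge0 ?sumr_ge0 // TE.
    exact: ler_norm_sum.
  apply: le_trans (ler_sqr_sum (mem R) (fun t => normr_ge0 (D t))) _.
  apply: ler_wpM2l => //; apply: le_trans sumD2.
  rewrite [leRHS](big_setID R) /= (setIidPr RG) lerDl sumr_ge0 // => t _.
  by rewrite exprn_ge0.
have -> : T ^+ 4 = (T ^+ 2) ^+ 2 by rewrite -exprM.
apply: le_trans (_ : (#|R|%:R * (N ^+ 2 * #|A|%:R * sqrtC (#|B| ^ 3 * n ^ 2 * M)%:R)) ^+ 2 <= _).
  rewrite ler_sqr ?nnegrE //; first by rewrite -real_normK // exprn_ge0.
  by rewrite !mulr_ge0 ?exprn_ge0 ?sqrtC_ge0 // ler0n.
rewrite !exprMn sqrtCK /N -!natrX -!natrM ler_nat.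
by apply: eq_leq; ring.
Qed.

End Incidences.

End Characters.

(** * Passage to real exponents *)

Lemma powR_natX (K : realType) (a x : K) (k j : nat) :
  0 <= a -> x * k%:R = j%:R -> (a `^ x) ^+ k = a ^+ j.
Proof. by move=> a0 e; rewrite -powR_mulrn ?powR_ge0 // -powRrM e powR_mulrn. Qed.

(** Fourth powers are compared: dividing by [n ^ 8] leaves [n ^ 2 * M], and 16 is the fourth power
    of the constant 2. *)
Lemma incidence_powR_bound (K : realType) (p r M E : nat) (e : K)
    (A B : {set 'cV['Z_(p ^ r)%N]_2})
    (R : {set 'M['Z_(p ^ r)%N]_2 * 'cV['Z_(p ^ r)%N]_2}) :
  (1 < p ^ r)%N -> R \subset rigid_motions (p ^ r)%N ->
  (forall m : 'rV['Z_(p ^ r)%N]_2, m != 0 ->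
   forall u : 'M['Z_(p ^ r)%N]_2 -> algC, (forall g, 0 <= u g) ->
   energy (fun q : 'M['Z_(p ^ r)%N]_2 * 'M['Z_(p ^ r)%N]_2 => m *m (q.1 + q.2))
     u (setX (SO2 (p ^ r)) (SO2 (p ^ r)))
   <= M%:R * (\sum_(g in SO2 (p ^ r)%N) u g ^+ 2) ^+ 2) ->
  e * 4%:R = E%:R -> ((p ^ r) ^ 2 * M <= 16 * p ^ E)%N ->
  `| (incidences (setX A B) R)%:R
     - #|setX A B|%:R * #|R|%:R / p%:R ^+ (2 * r)%N |
  <= 2 * (p%:R `^ e * #|setX A B|%:R `^ (1 / 2)
          * #|R|%:R `^ (1 / 2) * #|B|%:R `^ (1 / 4)) :> K.
Proof.
move=> n1 RG energyM eE ME.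
have [z zn] := C_prim_root_exists (ltnW n1).
have := incidence_bound n1 zn A B RG energyM.
rewrite -(ler_int K) rmorphXn /= rmorphB /= -!pmulrn cardsX.
set n := (p ^ r)%N in n1 ME *.
set I := incidences _ _; set x := `| _ |; set Y := _ * _ `^ (1 / 4) => bound.
have n0 : (n%:R : K) != 0 by rewrite pnatr_eq0 -lt0n ltnW.
have pnE : p%:R ^+ (2 * r) = n%:R ^+ 2 :> K by rewrite /n natrX -exprM mulnC.
have Y0 : 0 <= Y by rewrite !mulr_ge0 ?powR_ge0.
have YE : Y ^+ 4 = (p ^ E * (#|A| * #|B|) ^ 2 * #|R| ^ 2 * #|B|)%:R.
  have half4 : (1 / 2) * 4%:R = 2%:R :> K by field.
  have quarter4 : (1 / 4) * 4%:R = 1%:R :> K by field.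
  rewrite !exprMn (powR_natX _ eE) // !(powR_natX _ half4) //.
  rewrite (powR_natX _ quarter4) //.
  by rewrite -!natrX -!natrM.
rewrite -(@ler_pXn2r _ 4) ?nnegrE ?normr_ge0 ?mulr_ge0 ?powR_ge0 //.
have -> : x ^+ 4 = ((n ^ 2 * I)%:R - (#|A| * #|B| * #|R|)%:R) ^+ 4 / n%:R ^+ 8.
  rewrite /x -normrX ger0_norm; last first.
    by rewrite -[4%N]/(2 * 2)%N exprM sqr_ge0.
  rewrite pnE [(#|A| * #|B| * #|R|)%:R]natrM.
  have -> : (n ^ 2 * I)%:R = n%:R ^+ 2 * I%:R :> K by rewrite -natrX -natrM.
  by move: (n%:R) n0 => N N0; field.
rewrite ler_pdivrMr; last by rewrite exprn_gt0 // ltr0n ltnW.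
apply: le_trans bound _; rewrite exprMn YE -!natrX -!natrM ler_nat.
have -> : (n ^ 10 * #|R| ^ 2 * #|A| ^ 2 * #|B| ^ 3 * M =
  (n ^ 2 * M) * (n ^ 8 * #|R| ^ 2 * #|A| ^ 2 * #|B| ^ 3))%N by ring.
apply: leq_trans (leq_mul ME (leqnn _)) _.
by apply: eq_leq; ring.
Qed.

Theorem theorem3p2 (K : realType) :
  exists2 C : K, 0 < C &
  forall (p r : nat) (A B : {set 'cV['Z_(p ^ r)%N]_2})
    (R : {set 'M['Z_(p ^ r)%N]_2 * 'cV['Z_(p ^ r)%N]_2}),
    prime p -> odd p -> (1 <= r)%N -> R \subset rigid_motions (p ^ r)%N ->
    let P := setX A B in
    ((p %% 4 = 3)%N ->
       `| (incidences P R)%:R - #|P|%:R * #|R|%:R / p%:R ^+ (2 * r)%N |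
         <= C * (p%:R `^ (r%:R - 1 / 2) * #|P|%:R `^ (1 / 2)
                 * #|R|%:R `^ (1 / 2) * #|B|%:R `^ (1 / 4))) /\
    ((p %% 4 = 1)%N ->
       `| (incidences P R)%:R - #|P|%:R * #|R|%:R / p%:R ^+ (2 * r)%N |
         <= C * (p%:R `^ (r%:R - 1 / 4) * #|P|%:R `^ (1 / 2)
                 * #|R|%:R `^ (1 / 2) * #|B|%:R `^ (1 / 4))).
Proof.
exists 2 => [|p r A B R pp op r1 RG P]; first exact: ltr0n.
have n1 : (1 < p ^ r)%N by rewrite -(exp1n r) ltn_exp2r // prime_gt1.
have nE : (p ^ r = p * p ^ r.-1)%N by rewrite -expnS prednK.
split=> pmod.
  (* Here [E] is 4r - 2, four times r - 1/2, and [n ^ 2 * M] is 6 p^(4r-2), with 6 below 16. *)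
  apply: (@incidence_powR_bound K p r (6 * (p ^ r.-1) ^ 2) (4 * r.-1 + 2)) => //.
  - by move=> m m0 u u0; apply: energy_SO2_3mod4.
  - rewrite -[in LHS](prednK r1) natrD natrM -natr1.
    by field.
  - rewrite nE expnD (mulnC 4) expnM.
    set q := (p ^ _)%N.
    have -> : ((p * q) ^ 2 * (6 * q ^ 2) = 6 * (q ^ 4 * p ^ 2))%N by ring.
    by rewrite leq_mul2r orbT.
(* Here [E] is 4r - 1, four times r - 1/4, and [n ^ 2 * M] is 2 p^(4r-1). *)
apply: (@incidence_powR_bound K p r (2 * p ^ r * p ^ r.-1) (4 * r.-1 + 3)) => //.
- by move=> m m0 u u0; apply: energy_SO2.
- rewrite -[in LHS](prednK r1) natrD natrM -natr1.
  by field.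
- rewrite nE expnD (mulnC 4) expnM.
  set q := (p ^ _)%N.
  have -> : ((p * q) ^ 2 * (2 * (p * q) * q) = 2 * (q ^ 4 * p ^ 3))%N by ring.
  by rewrite leq_mul2r orbT.
Qed.
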